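(* Let $K$ be the Klein bottle, so $\pi_1(K)=\langle a,b\mid abab^{-1}\rangle$. For every integer $n\ge 0$, the group $\pi_1(K)\times\mathbb Z^n$ has the $R_\infty$ property.
   Context: For an endomorphism $\varphi:G\to G$ of a group, $G$ acts on itself by $\sigma\cdot\alpha=\sigma\alpha\varphi(\sigma)^{-1}$. The Reidemeister number $R(\varphi)$ is the number of orbits of this action ($\infty$ if there are infinitely many). A group $G$ has the $R_\infty$ property if $R(\varphi)=\infty$ for every automorphism $\varphi$ of $G$. *)

(* Defs.v *)
From HB Require Import structures.
From mathcomp Require Import all_boot all_algebra.
From mathcomp Require Import boolp classical_sets cardinality finmap.
From mathcomp Require Import constructive_ereal.

Set Implicit Arguments.
Unset Strict Implicit.
Unset Printing Implicit Defensive.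

Local Open Scope classical_set_scope.
Local Open Scope group_scope.

Section Reidemeister.
Variables (G : groupType) (phi : {multiplicative G -> G}).

Definition twisted_act (sigma alpha : G) : G := sigma * alpha * (phi sigma)^-1.

Definition twisted_orbit (alpha : G) : set G :=
  range (fun sigma => twisted_act sigma alpha).

Definition twisted_orbits : set (set G) := range twisted_orbit.

Definition reidemeister_number : \bar nat :=
  if `[< finite_set twisted_orbits >]
  then EFin (#|` fset_set twisted_orbits|)%fset else +oo%E.

End Reidemeister.

(* A multiplicative map between groups automatically preserves 1 and inverses,
   so a bijective one is a group automorphism. *)
Definition R_infty (G : groupType) : Prop :=
  forall phi : {multiplicative G -> G}, bijective phi ->
    reidemeister_number phi = +oo%E.

(* The group < X | R >: words in X and formal inverses, modulo the congruence
   generated by free cancellation and by r ~ 1 for each relator r in R.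
   The letter (x, false) stands for x, and (x, true) for x^-1. *)
Section Presentation.
Variable X : choiceType.

Definition word := seq (X * bool).

Definition word_inv (w : word) : word := rev [seq (l.1, ~~ l.2) | l <- w].

Variable R : set word.

Inductive word_equiv : word -> word -> Prop :=
| word_equiv_refl u : word_equiv u u
| word_equiv_sym u v : word_equiv u v -> word_equiv v u
| word_equiv_trans u v w :
    word_equiv u v -> word_equiv v w -> word_equiv u w
| word_equiv_cancel u x e v :
    word_equiv (u ++ [:: (x, e); (x, ~~ e)] ++ v) (u ++ v)
| word_equiv_relator u r v : R r -> word_equiv (u ++ r ++ v) (u ++ v).

Lemma word_equiv_cat u u' v v' :
  word_equiv u u' -> word_equiv v v' -> word_equiv (u ++ v) (u' ++ v').
Proof.
move=> uu' vv'; apply: (@word_equiv_trans _ (u' ++ v)).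
  elim: uu' => {u u' vv'} [u|u w _|u w z _ IH _|u x e w|u r w Rr].
  - exact: word_equiv_refl.
  - exact: word_equiv_sym.
  - exact: word_equiv_trans.
  - by rewrite -!catA; exact: word_equiv_cancel.
  - by rewrite -!catA; exact: word_equiv_relator.
elim: vv' => {v v' uu'} [v|v w _|v w z _ IH _|v x e w|v r w Rr].
- exact: word_equiv_refl.
- exact: word_equiv_sym.
- exact: word_equiv_trans.
- by rewrite !(catA u'); exact: word_equiv_cancel.
- by rewrite !(catA u'); exact: word_equiv_relator.
Qed.

Lemma word_invK : involutive word_inv.
Proof.
move=> w; rewrite /word_inv map_rev revK -map_comp -[RHS]map_id.
by apply: eq_map => -[x e] /=; rewrite negbK.
Qed.

Lemma word_inv_cat u v : word_inv (u ++ v) = word_inv v ++ word_inv u.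
Proof. by rewrite /word_inv map_cat rev_cat. Qed.

Lemma word_equivV w : word_equiv (w ++ word_inv w) [::].
Proof.
elim: w => [|[x e] w IH]; first exact: word_equiv_refl.
have -> : ((x, e) :: w) ++ word_inv ((x, e) :: w) =
    [:: (x, e)] ++ (w ++ word_inv w) ++ [:: (x, ~~ e)].
  by rewrite /word_inv /= rev_cons -cats1 !catA.
apply: (@word_equiv_trans _ ([:: (x, e)] ++ [::] ++ [:: (x, ~~ e)])).
  apply: word_equiv_cat; first exact: word_equiv_refl.
  by apply: word_equiv_cat => //; exact: word_equiv_refl.
exact: (@word_equiv_cancel [::] x e [::]).
Qed.

Lemma word_equiv_inv u v :
  word_equiv u v -> word_equiv (word_inv u) (word_inv v).
Proof.
move=> uv; apply: (@word_equiv_trans _ (word_inv u ++ v ++ word_inv v)).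
  rewrite -[X in word_equiv X _]cats0.
  apply: word_equiv_cat; first exact: word_equiv_refl.
  exact/word_equiv_sym/word_equivV.
rewrite catA -[X in word_equiv _ X]cat0s.
apply: word_equiv_cat; last exact: word_equiv_refl.
apply: (@word_equiv_trans _ (word_inv u ++ u)).
  apply: word_equiv_cat; [exact: word_equiv_refl|exact: word_equiv_sym].
by rewrite -{2}[u]word_invK; exact: word_equivV.
Qed.

Definition word_equivb : rel word := fun u v => `[< word_equiv u v >].

Lemma word_equivb_refl : reflexive word_equivb.
Proof. by move=> u; apply/asboolP; exact: word_equiv_refl. Qed.

Lemma word_equivb_sym : symmetric word_equivb.
Proof.
by move=> u v; apply/asboolP/asboolP => ?; exact: word_equiv_sym.
Qed.

Lemma word_equivb_trans : transitive word_equivb.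
Proof.
move=> v u w /asboolP uv /asboolP vw.
by apply/asboolP; exact: word_equiv_trans uv vw.
Qed.

Canonical word_equiv_rel :=
  EquivRel word_equivb word_equivb_refl word_equivb_sym word_equivb_trans.

Local Open Scope quotient_scope.

Definition presented : Type := {eq_quot word_equiv_rel}.
HB.instance Definition _ := Choice.on presented.
HB.instance Definition _ := EqQuotient.on presented.

Definition word_class (w : word) : presented := \pi_presented w.

Lemma word_classP u v : word_class u = word_class v <-> word_equiv u v.
Proof.
by split=> [/eqquotP/asboolP //|uv]; apply/eqquotP/asboolP.
Qed.

Lemma repr_word_class w : word_equiv (repr (word_class w)) w.
Proof. by apply/word_classP; rewrite /word_class reprK. Qed.

Definition presented_mul (g h : presented) : presented :=
  word_class (repr g ++ repr h).
Definition presented_one : presented := word_class [::].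
Definition presented_inv (g : presented) : presented :=
  word_class (word_inv (repr g)).

Lemma word_class_cat u v :
  word_class (u ++ v) = presented_mul (word_class u) (word_class v).
Proof.
apply/word_classP/word_equiv_sym.
by apply: word_equiv_cat; exact: repr_word_class.
Qed.

Lemma word_class_inv u :
  word_class (word_inv u) = presented_inv (word_class u).
Proof.
by apply/word_classP/word_equiv_sym/word_equiv_inv/repr_word_class.
Qed.

Lemma word_class_surj (P : presented -> Prop) :
  (forall w, P (word_class w)) -> forall g, P g.
Proof. by move=> Pw g; rewrite -[g]reprK; exact: Pw. Qed.

Lemma presented_mulA : associative presented_mul.
Proof.
elim/word_class_surj=> u; elim/word_class_surj=> v; elim/word_class_surj=> w.
by rewrite -!word_class_cat catA.
Qed.

Lemma presented_mul1 : left_id presented_one presented_mul.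
Proof. by elim/word_class_surj=> u; rewrite -word_class_cat. Qed.

Lemma presented_mulr1 : right_id presented_one presented_mul.
Proof. by elim/word_class_surj=> u; rewrite -word_class_cat cats0. Qed.

Lemma presented_mulrV : right_inverse presented_one presented_inv presented_mul.
Proof.
elim/word_class_surj=> u; rewrite -word_class_inv -word_class_cat.
by apply/word_classP; exact: word_equivV.
Qed.

Lemma presented_mulV : left_inverse presented_one presented_inv presented_mul.
Proof.
elim/word_class_surj=> u; rewrite -word_class_inv -word_class_cat.
by apply/word_classP; rewrite -{2}[u]word_invK; exact: word_equivV.
Qed.

HB.instance Definition _ := isGroup.Build presented presented_mulA
  presented_mul1 presented_mulr1 presented_mulV presented_mulrV.

End Presentation.

(* < a, b | a b a b^-1 >, with generators a = 0 and b = 1 in 'I_2. *)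
Definition klein_relator : word 'I_2 :=
  let a : 'I_2 := ord0 in let b : 'I_2 := ord_max in
  [:: (a, false); (b, false); (a, false); (b, true)].

Definition klein_group : groupType := presented [set klein_relator].

(* Z^n, written multiplicatively. *)
Definition Zpow (n : nat) : groupType := {ffun 'I_n -> Algebra.to_multiplicative int}.

(* Main.v *)
(* In G = pi_1(K) x Z^n the subgroup A = <a> is the kernel of the projection p
   onto Z^(1+n), and b inverts A.  An element conjugate to its inverse lies in A,
   so an automorphism phi preserves A, acts on it by a sign, and induces an
   integer matrix M on Z^(1+n).  If 1 - M is singular, the induced map already
   has infinitely many twisted classes.  Otherwise M has no nonzero fixed vector,
   so only sigma in A can relate two elements of the same coset A c; choosing
   c = 1 or c = b so that phi followed by conjugation by c is the identity on A,
   the elements a^i c are pairwise inequivalent. *)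
From HB Require Import structures.
Require Import Defs.
From mathcomp Require Import all_boot all_algebra.
From mathcomp Require Import boolp classical_sets cardinality constructive_ereal.
From mathcomp Require Import zify.

Set Implicit Arguments.
Unset Strict Implicit.
Unset Printing Implicit Defensive.

Import GRing.Theory.
Local Open Scope ring_scope.
Local Open Scope group_scope.

(** * A criterion for an infinite Reidemeister number *)

Section GroupMorphism.
Variables (G H : groupType) (f : G -> H).
Hypothesis fM : {morph f : x y / x * y}.

Lemma morphg1 : f 1 = 1.
Proof. by apply: (@mulIg _ (f 1)); rewrite -fM !mul1g. Qed.

Lemma morphgV : {morph f : x / x^-1}.
Proof. by move=> x; apply/esym/mulg1_eq; rewrite -fM mulgV morphg1. Qed.

End GroupMorphism.

(** Each [u j] lies in its own orbit (take [sigma = 1]), so [i |-> twisted_orbit phi (u i)] is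
    injective, and finitely many orbits would make [nat] finite. *)
Lemma reidemeister_infty (G : groupType) (phi : {multiplicative G -> G})
    (u : nat -> G) :
  (forall i j, twisted_orbit phi (u i) (u j) -> i = j) ->
  reidemeister_number phi = +oo%E.
Proof.
move=> u_inj; rewrite /reidemeister_number; case: asboolP => // fin_orb.
have : finite_set
    ((fun i => twisted_orbit phi (u i)) @^-1` twisted_orbits phi)%classic.
  apply: finite_preimage fin_orb => i j _ _ /= eq_ij; apply: u_inj.
  rewrite eq_ij; exists 1 => //.
  by rewrite /twisted_act (morphg1 (@gmulfM _ _ phi)) invg1 mulg1 mul1g.
rewrite (_ : preimage _ _ = [set: nat]%classic) => [/infinite_nat//|].
by rewrite -subTset => i _; exists (u i).
Qed.

(** * Linear algebra over the integers *)

Lemma additive_int_mx m n (F : 'rV[int]_m -> 'rV[int]_n) :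
  {morph F : u v / (u + v)%R} -> exists M, forall v, F v = (v *m M)%R.
Proof.
move=> F_add.
have F0 : F 0%R = 0%R by apply: (addIr (F 0%R)); rewrite -F_add !add0r.
pose Fa : {additive _ -> _} :=
  HB.pack F (GRing.isNmodMorphism.Build _ _ F (conj F0 F_add)).
(* An integer scalar acts by repeated addition, so additivity already gives linearity. *)
have F_lin : linear F.
  move=> a u v; rewrite F_add -{1}(intz a) scaler_int.
  by rewrite -[X in (X + _)%R]/(Fa _) raddfMz -scaler_int intz.
pose Fl : {linear _ -> _} :=
  HB.pack F (GRing.isLinear.Build _ _ _ _ F F_lin).
by exists (lin1_mx Fl) => v; rewrite mul_rV_lin1.
Qed.

(** A matrix and its transpose have the same determinant. The column [w] will serve as a linear
    functional that vanishes on the row image of [M]. *)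
Lemma row_ker_col_ker (R : idomainType) m (M : 'M[R]_m) (v : 'rV[R]_m) :
  v != 0%R -> (v *m M)%R = 0%R ->
  exists2 w : 'cV[R]_m, w != 0%R & (M *m w)%R = 0%R.
Proof.
move=> v0 vM.
have /det0P[w w0 wM] : \det M^T == 0%R by rewrite det_tr; apply/det0P; exists v.
exists w^T%R; first by rewrite trmx_eq0.
by apply: trmx_inj; rewrite trmx_mul trmxK wM trmx0.
Qed.

(** * Integer powers in a group *)

Section IntegerPowers.
Variable G : groupType.
Implicit Types (x y : G) (i j : int).

Definition zexpg x i : G :=
  match i with Posz k => x ^+ k | Negz k => x ^- k.+1 end.

Lemma zexpgS x i : zexpg x (i + 1)%R = zexpg x i * x.
Proof.
case: i => k; first by rewrite addrC -intS /= expgSr.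
rewrite NegzE -addn1 PoszD opprD addrNK.
case: k => [|k]; first by rewrite mulVg.
by rewrite -NegzE /= addn0 (expgS x k.+1) invgM mulgVK.
Qed.

Lemma zexpgD x i j : zexpg x (i + j)%R = zexpg x i * zexpg x j.
Proof.
elim/int_rec: j => [|k IHk|k IHk]; first by rewrite addr0 mulg1.
  by rewrite -addn1 PoszD addrA !zexpgS IHk mulgA.
apply: (@mulIg _ x); rewrite -mulgA -!zexpgS -addn1 PoszD opprD.
by rewrite -addrA !addrNK.
Qed.

(** The integers are generated by 1, so a homomorphism out of them is determined by its value there.
    Identities between powers below are reduced to this. *)
Lemma zexpg_uniq (h : int -> G) :
  {morph h : i j / (i + j)%R >-> i * j} -> h =1 zexpg (h 1%R).
Proof.
move=> hD; have h0 : h 0%R = 1 by apply: (@mulIg _ (h 0%R)); rewrite -hD mul1g.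
elim/int_rec=> [|k IHk|k IHk] //; first by rewrite -addn1 PoszD hD zexpgS IHk.
apply: (@mulIg _ (h 1%R)); rewrite -hD -zexpgS -addn1 PoszD opprD.
by rewrite !addrNK.
Qed.

End IntegerPowers.

Lemma morph_zexpg (G H : groupType) (f : G -> H) x i :
  {morph f : x y / x * y} -> f (zexpg x i) = zexpg (f x) i.
Proof.
move=> fM; rewrite -[LHS]/((f \o zexpg x) i) zexpg_uniq => [|j k] /=.
  by rewrite expg1.
by rewrite zexpgD fM.
Qed.

Lemma zexpg_conjV (G : groupType) (x y : G) i :
  y * x * y^-1 = x^-1 -> y * zexpg x i * y^-1 = zexpg x (- i)%R.
Proof.
move=> xV; rewrite (morph_zexpg (f := fun z => y * z * y^-1)) => [|u v].
  rewrite xV -[LHS]/(zexpg (zexpg x (- 1)%R) i).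
  apply/esym/(zexpg_uniq (h := fun j => zexpg x (- j)%R)) => j k.
  by rewrite opprD zexpgD.
by rewrite !mulgA mulgVK.
Qed.

(** * Homomorphisms out of a presented group *)

Lemma word_classM (X : choiceType) (R : set (word X)) u v :
  word_class R (u ++ v) = word_class R u * word_class R v.
Proof. exact: word_class_cat. Qed.

Section PresentationLift.
Variables (X : choiceType) (R : set (word X)) (H : groupType) (f : X -> H).

Definition letter_eval (l : X * bool) : H := if l.2 then (f l.1)^-1 else f l.1.

Definition word_eval (w : word X) : H := \prod_(l <- w) letter_eval l.

Hypothesis f_rel : forall r, R r -> word_eval r = 1.

Lemma word_eval_equiv u v : word_equiv R u v -> word_eval u = word_eval v.
Proof.
elim=> {u v} [//|//|u v w _ -> _ ->//|u x e v|u r v /f_rel r1].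
  rewrite /word_eval !big_cat /= !big_cons big_nil mulg1 /letter_eval /=.
  by case: e; rewrite /= ?mulVg ?mulgV mul1g.
by rewrite /word_eval !big_cat /= -/(word_eval r) r1 mul1g.
Qed.

Definition presented_lift (g : presented R) : H := word_eval (repr g).

Lemma presented_liftE w : presented_lift (word_class R w) = word_eval w.
Proof. exact/word_eval_equiv/repr_word_class. Qed.

Lemma presented_liftM : {morph presented_lift : x y / x * y}.
Proof.
move=> x y; rewrite -[x * y]/(presented_mul x y) presented_liftE.
by rewrite /word_eval big_cat.
Qed.

End PresentationLift.

(* Z semidirect Z with the generator of the second factor acting by inversion. *)
Definition klein_model := (int * int)%type.
HB.instance Definition _ := Choice.on klein_model.

Definition klein_mul (g h : klein_model) : klein_model :=
  (g.1 + (-1) ^ g.2 * h.1, g.2 + h.2)%R.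
Definition klein_inv (g : klein_model) : klein_model :=
  (- ((-1) ^ (- g.2) * g.1), - g.2)%R.

Lemma exprN1zD (i j : int) : ((-1) ^ (i + j) = (-1) ^ i * (-1) ^ j :> int)%R.
Proof. by rewrite exprzDr. Qed.

Lemma klein_mulA : associative klein_mul.
Proof.
by move=> g h k; rewrite /klein_mul /= exprN1zD mulrDr !addrA mulrA.
Qed.

Lemma klein_mul1 : left_id (0, 0)%R klein_mul.
Proof. by move=> [i j]; rewrite /klein_mul /= expr0z mul1r !add0r. Qed.

Lemma klein_mulr1 : right_id (0, 0)%R klein_mul.
Proof. by move=> [i j]; rewrite /klein_mul /= mulr0 !addr0. Qed.

Lemma klein_mulV : left_inverse (0, 0)%R klein_inv klein_mul.
Proof. by move=> [i j]; rewrite /klein_mul /klein_inv /= !addNr. Qed.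

Lemma klein_mulrV : right_inverse (0, 0)%R klein_inv klein_mul.
Proof.
move=> [i j]; rewrite /klein_mul /klein_inv /= mulrN mulrA -exprN1zD subrr.
by rewrite expr0z mul1r subrr.
Qed.

HB.instance Definition _ := isGroup.Build klein_model klein_mulA
  klein_mul1 klein_mulr1 klein_mulV klein_mulrV.

(** * Exponents and normal form in the Klein bottle group *)

Definition klein_letter (x : 'I_2) : klein_model :=
  if x == ord0 then (1, 0)%R else (0, 1)%R.

Lemma klein_letter_rel r :
  [set klein_relator]%classic r -> word_eval klein_letter r = 1.
Proof. by move=> ->; rewrite /word_eval !big_cons big_nil. Qed.

(** Reads off the exponents of a normal form [a^i b^j]; in particular it shows that [a] has infinite
    order. *)
Definition klein_coord : klein_group -> klein_model :=
  @presented_lift _ [set klein_relator]%classic _ klein_letter.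

Lemma klein_coordM : {morph klein_coord : g h / g * h}.
Proof. exact/presented_liftM/klein_letter_rel. Qed.

Definition klein_a : klein_group := word_class _ [:: (ord0, false)].
Definition klein_b : klein_group := word_class _ [:: (ord_max, false)].

Lemma klein_conj : klein_b * klein_a * klein_b^-1 = klein_a^-1.
Proof.
(* Moved to one side, the claim is that the relator [a b a b^-1] is trivial. *)
apply/esym/mulg1_eq; rewrite !mulgA.
pose R : set (word 'I_2) := [set klein_relator]%classic.
have bV : word_class R [:: (ord_max, true)] = klein_b^-1.
  exact: (word_class_inv R [:: (ord_max, false)]).
have : word_class R ([:: (ord0, false)] ++ [:: (ord_max, false)] ++
    [:: (ord0, false)] ++ [:: (ord_max, true)]) = 1.
  by apply/word_classP; exact: (@word_equiv_relator _ R [::] klein_relator [::]).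
by rewrite !word_classM bV -!mulgA.
Qed.

Lemma klein_conjz i :
  klein_b * zexpg klein_a i * klein_b^-1 = zexpg klein_a (- i)%R.
Proof. exact/zexpg_conjV/klein_conj. Qed.

(** Induction on a word, one letter prepended at a time: [a^±1] shifts [i], while [b^±1] crosses
    [a^i] by negating [i] and then shifts [j]. *)
Lemma klein_normal_form g : exists i j, g = zexpg klein_a i * zexpg klein_b j.
Proof.
elim/word_class_surj: g; elim=> [|[x e] w [i [j wE]]].
  by exists 0%R, 0%R; rewrite mulg1.
have -> : word_class [set klein_relator]%classic ((x, e) :: w) =
    (if e then (word_class _ [:: (x, false)])^-1
     else word_class _ [:: (x, false)])
    * word_class [set klein_relator]%classic w.
  rewrite -cat1s word_classM; case: e => //.
  by rewrite -[_^-1]/(presented_inv _) -word_class_inv.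
rewrite wE; have [->|->] : x = ord0 \/ x = ord_max.
  by case: x => [[|[|//]] ltx]; [left|right]; apply: val_inj.
  exists (if e then i - 1 else i + 1)%R, j; rewrite -/klein_a mulgA.
  by case: e; rewrite addrC zexpgD.
exists (- i)%R, (if e then j - 1 else j + 1)%R; rewrite -/klein_b.
case: e; rewrite addrC zexpgD /= ?expg1 mulgA; last first.
  by rewrite -klein_conjz !mulgA mulgVK.
by rewrite -{1}[i]opprK -(klein_conjz (- i)%R) !mulgA mulVg mul1g.
Qed.

Lemma klein_coord_gen x :
  klein_coord (word_class _ [:: (x, false)]) = klein_letter x.
Proof.
rewrite /klein_coord presented_liftE; last exact: klein_letter_rel.
by rewrite /word_eval big_seq1.
Qed.

Lemma klein_coord_a (i : int) : klein_coord (zexpg klein_a i) = (i, 0)%R.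
Proof.
rewrite (morph_zexpg _ _ klein_coordM) klein_coord_gen.
apply/esym/(zexpg_uniq (h := fun i : int => (i, 0%R) : klein_model)) => x y.
by congr (_, _); rewrite expr0z mul1r.
Qed.

Lemma klein_coord_b (j : int) : klein_coord (zexpg klein_b j) = (0, j)%R.
Proof.
rewrite (morph_zexpg _ _ klein_coordM) klein_coord_gen.
apply/esym/(zexpg_uniq (h := fun j : int => (0%R, j) : klein_model)) => x y.
by congr (_, _); rewrite mulr0.
Qed.

(** * Extensions of a free abelian group by an infinite cyclic kernel *)

Lemma R_infty_free_abelian_ext (G : groupType) m (p : G -> 'rV[int]_m)
    (s : 'rV[int]_m -> G) (A : int -> G) (b : G) :
    {morph p : x y / x * y >-> (x + y)%R} -> cancel s p ->
    {morph A : i j / (i + j)%R >-> i * j} -> injective A ->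
    (forall g, p g = 0%R <-> exists i, g = A i) ->
    (forall i, b * A i * b^-1 = A (- i)%R) ->
  R_infty G.
Proof.
move=> pM sK AD A_inj ker_p conj_b phi phi_bij.
have phiM := @gmulfM _ _ phi; have phiV := morphgV phiM.
have p1 : p 1 = 0%R by apply: (addIr (p 1)); rewrite -pM mulg1 add0r.
have pV g : p g^-1 = (- p g)%R by apply: (addIr (p g)); rewrite -pM mulVg addNr.
have pA i : p (A i) = 0%R by apply/ker_p; exists i.
have A0 : A 0%R = 1 by apply: (@mulIg _ (A 0%R)); rewrite -AD mul1g.
have AN i : A (- i)%R = (A i)^-1.
  by apply/esym/mulg1_eq; rewrite -AD subrr.
(* The target of [p] is abelian, so the conjugation disappears and [p x = - p x], which forces 0 in
   a torsion-free group. *)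
have inv_ker c x : c * x * c^-1 = x^-1 -> p x = 0%R.
  move/(congr1 p); rewrite !pM !pV addrC addKr => pxN.
  have eqN0 (z : int) : z = (- z)%R -> z = 0%R by lia.
  by apply/rowP => k; move/rowP/(_ k): pxN; rewrite !mxE; exact: eqN0.
have pphiA i : p (phi (A i)) = 0%R.
  by apply: (inv_ker (phi b)); rewrite -!phiV -!phiM conj_b AN.
(* The map induced by [phi] on the quotient, computed through the set-theoretic section [s]. *)
pose F v := p (phi (s v)).
have pphi g : p (phi g) = F (p g).
  have /ker_p[k gE] : p ((s (p g))^-1 * g) = 0%R by rewrite pM pV sK addNr.
  by rewrite -[g in LHS](mulVKg (s (p g))) gE phiM pM pphiA addr0.
have [|M FM] := @additive_int_mx _ _ F.
  by move=> x y; rewrite -{1}[x]sK -{1}[y]sK -pM -pphi phiM pM.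
(* If [1 - M] is singular, a nonzero [w] in its right kernel makes
   [g |-> p g *m w] constant on twisted orbits. *)
case: (eqVneq (\det (1%:M - M)%R) 0%R) => [/eqP/det0P[v v0 vM] | detM].
  have [w /cV0Pn[k wk] Mw] := row_ker_col_ker v0 vM.
  (* On the [i]-th representative the invariant equals [i] times the [k]-th entry of [w], which is
     nonzero. *)
  apply: (@reidemeister_infty _ _ (fun i => s (i%:Z *: delta_mx 0 k)%R)) => i j.
  move=> [sg _]; rewrite /twisted_act => /(congr1 (fun g => (p g *m w)%R 0%R 0%R)).
  rewrite !pM pV !sK pphi FM.
  have -> : (p sg + i%:Z *: delta_mx 0 k - p sg *m M =
            p sg *m (1%:M - M) + i%:Z *: delta_mx 0 k)%R.
    by rewrite mulmxBr mulmx1 addrAC.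
  rewrite mulmxDl -mulmxA Mw mulmx0 add0r -!scalemxAl -!rowE !mxE.
  by move/(mulIf wk) => [].
have fix0 g : p (phi g) = p g -> p g = 0%R.
  rewrite pphi FM => pg; apply/eqP; apply: contraNT detM => pg0.
  by apply/det0P; exists (p g); rewrite // mulmxBr mulmx1 pg subrr.
have [e phiA1] : exists e, phi (A 1%R) = A e by apply/ker_p.
have phiA i : phi (A i) = A (e * i)%R.
  have -> : A (e * i)%R = zexpg (A (e * 1)%R) i.
    by apply: (zexpg_uniq (h := fun i => A (e * i)%R)) => x y; rewrite mulrDr AD.
  rewrite mulr1 -phiA1; apply: (zexpg_uniq (h := phi \o A)) => x y.
  by rewrite /= AD phiM.
(* The inverse [psi] also maps [A 1] into the kernel, say to [A k]; then [e * k = 1]. *)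
have e_unit : (e = 1 \/ e = -1)%R.
  have [psi psiK phiK] := phi_bij.
  have psiM : {morph psi : x y / x * y} by exact: can2_gmulfM.
  have /ker_p[k psiA] : p (psi (A 1%R)) = 0%R.
    apply: (inv_ker (psi b)).
    by rewrite -!(morphgV psiM) -!psiM conj_b AN.
  have /A_inj : A (e * k)%R = A 1%R by rewrite -phiA -psiA phiK.
  move/(congr1 absz)/eqP; rewrite abszM muln_eq1 => /andP[/eqP + _].
  by lia.
(* Composing [phi] with conjugation by [c] fixes [A] pointwise: [c] is [1] or [b]
   according to the sign of [e]. *)
have [c cP] : exists c, forall k, c * phi (A k) * c^-1 = A k.
  case: e_unit => eE; rewrite eE in phiA.
    by exists 1 => k; rewrite phiA mul1r mul1g invg1 mulg1.
  by exists b => k; rewrite phiA mulN1r conj_b opprK.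
apply: (@reidemeister_infty _ _ (fun i => A i%:Z * c)) => i j [sg _].
rewrite /twisted_act => sgE.
(* All [A i * c] have the same image under [p], so the relation forces [p (phi sg) = p sg]. *)
have /ker_p[k sgA] : p sg = 0%R.
  apply: fix0; move/(congr1 p): sgE; rewrite !pM pV !pA !add0r.
  by rewrite addrAC -[RHS]add0r => /addIr/subr0_eq.
(* Moving [phi (A k)^-1] across [c] turns it into [A (- k)], which cancels the factor [A k] on the
   left. *)
have phiAk : (phi (A k))^-1 = c^-1 * A (- k)%R * c.
  by rewrite AN -[in RHS]cP !invgM invgK !mulgA mulVg mul1g mulgVK.
move: sgE; rewrite sgA phiAk !mulgA mulgK => /mulIg.
by rewrite -!AD addrAC subrr add0r => /A_inj [].
Qed.

(** * The product of the Klein bottle group with a free abelian group *)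

Theorem theorem2p4 (n : nat) : R_infty (klein_group * Zpow n)%type.
Proof.
(* The first coordinate of [p] is the exponent of [b]; the others are the free abelian factor. *)
pose p (g : klein_group * Zpow n) : 'rV[int]_(1 + n) :=
  row_mx (\row__ (klein_coord g.1).2) (\row_i g.2 i).
pose s (v : 'rV[int]_(1 + n)) : klein_group * Zpow n :=
  (zexpg klein_b (lsubmx v 0%R 0%R), [ffun i => rsubmx v 0%R i]).
pose A (i : int) : klein_group * Zpow n := (zexpg klein_a i, 1).
apply: (@R_infty_free_abelian_ext _ _ p s A (klein_b, 1)).
- move=> [g y] [h z]; rewrite /p add_row_mx /= klein_coordM.
  by congr row_mx; apply/rowP=> i; rewrite !mxE // ffunE.
- move=> v; rewrite /p /s /= klein_coord_b -[RHS]hsubmxK.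
  by congr row_mx; apply/rowP=> i; rewrite !mxE ?ord1 ?ffunE ?mxE.
- by move=> i j; congr (_, _); rewrite ?zexpgD ?mulg1.
- by move=> i j [] /(congr1 klein_coord); rewrite !klein_coord_a => -[].
- move=> [g z]; split=> [|[i [-> ->]]].
    rewrite -[0%R]row_mx0 => /eq_row_mx[/rowP/(_ 0%R) + /rowP zE]; rewrite !mxE /=.
    have [i [j ->]] := klein_normal_form g.
    rewrite klein_coordM klein_coord_a klein_coord_b /= add0r => ->.
    exists i; congr (_, _); first by rewrite mulg1.
    by apply/ffunP => k; move: (zE k); rewrite !mxE ffunE.
  rewrite /p /= klein_coord_a -[RHS]row_mx0.
  by congr row_mx; apply/rowP=> k; rewrite !mxE // ffunE.
- by move=> i; congr (_, _); rewrite /= ?klein_conjz // !mul1g invg1.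
Qed.
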